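(* The translation $\mathcal T$ is a macro-expressible embedding of the $\lambda$-calculus into inheritance-calculus.
   Context: **Macro-expressibility (after Felleisen, ''On the expressive power of programming languages'', 1991).** A construct $C$ of language $\mathscr L_1$ is macro-expressible in language $\mathscr L_0$ if there exists a translation $\mathcal E$ such that for every program $P$ containing occurrences of $C$, the translation $\mathcal E(P)$ is obtained by replacing each occurrence of $C$ with an $\mathscr L_0$ expression that depends only on $C$'s subexpressions, leaving all other constructs of $P$ unchanged. In the claim, $\mathscr L_1$ is the $\lambda$-calculus, $\mathscr L_0$ is inheritance-calculus, the constructs $C$ are variable, $\lambda$-abstraction and application, and $\mathcal T$ plays the role of $\mathcal E$. Only the syntax of the two languages enters this definition. **$\lambda$-calculus.** Terms $M::=x\mid\lambda x.M\mid M_1\,M_2$. **Inheritance-calculus (syntax).** Its primitives are mixin, definition and reference. Labels are strings. A mixin body is a finite sequence of members; a member is a reference (a finite sequence of labels $[\ell_1,\dots,\ell_k]$, optionally with a null marker in second position) or a definition $\ell: m$ of a label $\ell$ by a mixin body $m$. A program is a mixin body. **Translation $\mathcal T$.** The two languages share a single variable alphabet: variable names are labels, disjoint from the five labels \texttt{\_\_whnf}, \texttt{\_\_parameter}, \texttt{\_\_result}, \texttt{\_\_call}, \texttt{\_\_callee}. - $\mathcal T(x)$ is the mixin body with the single reference $[x]$. - $\mathcal T(\lambda x.M)$ is the mixin body with the single definition \texttt{\_\_whnf}, whose body has three definitions: $x$ (body: the single reference $[\texttt{\_\_parameter}]$), \texttt{\_\_parameter} (empty body), \texttt{\_\_result}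 (body $\mathcal T(M)$). - $\mathcal T(M_1\,M_2)$ is the mixin body with three definitions: \texttt{\_\_callee} (body $\mathcal T(M_1)$), \texttt{\_\_call} (body: the reference $[\texttt{\_\_callee},\texttt{\_\_whnf}]$ and the definition of \texttt{\_\_parameter} with body $\mathcal T(M_2)$), \texttt{\_\_whnf} (body: the single reference $[\texttt{\_\_call},\texttt{\_\_result},\texttt{\_\_whnf}]$). *)

(* Defs.v *)
From HB Require Import structures.
From Stdlib Require Import String.
From mathcomp Require Import all_boot.

Set Implicit Arguments.
Unset Strict Implicit.
Unset Printing Implicit Defensive.

HB.instance Definition _ := hasDecEq.Build string String.eqb_spec.

Definition label := string.

Definition lbl_whnf : label := "__whnf"%string.
Definition lbl_parameter : label := "__parameter"%string.
Definition lbl_result : label := "__result"%string.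
Definition lbl_call : label := "__call"%string.
Definition lbl_callee : label := "__callee"%string.

Definition reserved : seq label :=
  [:: lbl_whnf; lbl_parameter; lbl_result; lbl_call; lbl_callee].

Definition variable : Type := {x : label | x \notin reserved}.

(** ** Lambda-calculus *)

(** Raw terms: no quotient by alpha-equivalence. *)
Inductive term : Type :=
| Var (x : variable)
| Lam (x : variable) (M : term)
| App (M1 M2 : term).

Inductive construct : Type := CVar | CLam | CApp.

(** The immediate constituents of a construct are of two kinds: variable names
    and subterms. *)
Definition name_arity (C : construct) : nat :=
  match C with CVar => 1 | CLam => 1 | CApp => 0 end.

Definition term_arity (C : construct) : nat :=
  match C with CVar => 0 | CLam => 1 | CApp => 2 end.

Definition build (C : construct) :
    ('I_(name_arity C) -> variable) -> ('I_(term_arity C) -> term) -> term :=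
  match C with
  | CVar => fun x _ => Var (x ord0)
  | CLam => fun x M => Lam (x ord0) (M ord0)
  | CApp => fun _ M => App (M ord0) (M ord_max)
  end.

(** ** Inheritance-calculus *)

(** [Path [:: l1; ...; lk]] is the reference [l1, ..., lk] without null marker;
    [NullPath l1 [:: l2; ...; lk]] is [l1, null, l2, ..., lk].  The type [L] of
    labels is a parameter because templates (below) also have label holes. *)
Inductive reference (L : Type) : Type :=
| Path (ls : seq L)
| NullPath (l : L) (ls : seq L).

Inductive member : Type :=
| Ref (r : reference label)
| Def (l : label) (m : seq member).

Definition mixin : Type := seq member.

(** ** Macro-expressibility *)

(** A template is a phrase of inheritance-calculus with metavariables: [n]
    label metavariables, allowed wherever a label is, and [k] mixin-body
    metavariables, allowed wherever a mixin body is.  These are the syntactic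
    abstractions of Felleisen. *)
Inductive label_template (n : nat) : Type :=
| LabelConst (l : label)
| LabelHole (i : 'I_n).

Inductive template (n k : nat) : Type :=
| BodyHole (i : 'I_k)
| Body (ms : seq (member_template n k))
with member_template (n k : nat) : Type :=
| TRef (r : reference (label_template n))
| TDef (l : label_template n) (b : template n k).

Definition map_reference (L L' : Type) (f : L -> L') (r : reference L) :
    reference L' :=
  match r with
  | Path ls => Path (map f ls)
  | NullPath l ls => NullPath (f l) (map f ls)
  end.

Definition fill_label (n : nat) (names : 'I_n -> label)
    (l : label_template n) : label :=
  match l with
  | LabelConst c => c
  | LabelHole i => names i
  end.

Fixpoint fill (n k : nat) (names : 'I_n -> label) (bodies : 'I_k -> mixin)
    (t : template n k) {struct t} : mixin :=
  match t with
  | BodyHole i => bodies i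
  | Body ms => map (fill_member names bodies) ms
  end
with fill_member (n k : nat) (names : 'I_n -> label) (bodies : 'I_k -> mixin)
    (t : member_template n k) {struct t} : member :=
  match t with
  | TRef r => Ref (map_reference (fill_label names) r)
  | TDef l b => Def (fill_label names l) (fill names bodies b)
  end.

(** [E] replaces every occurrence of the construct [C], in every program, by
    one and the same template, filled with the names of that occurrence and
    with the translations of its subterms. *)
Definition macro_expresses (E : term -> mixin) (C : construct) : Prop :=
  exists t : template (name_arity C) (term_arity C),
    forall (xs : 'I_(name_arity C) -> variable)
           (Ms : 'I_(term_arity C) -> term),
      E (build xs Ms) = fill (fun i => val (xs i)) (fun i => E (Ms i)) t.

(** All the constructs of the lambda-calculus are replaced, so there is no
    remaining construct to be left unchanged.  Embeddings are injective. *)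
Definition macro_expressible_embedding (E : term -> mixin) : Prop :=
  injective E /\ forall C : construct, macro_expresses E C.

(** ** The translation *)

Fixpoint translate (M : term) : mixin :=
  match M with
  | Var x => [:: Ref (Path [:: val x])]
  | Lam x M =>
      [:: Def lbl_whnf
            [:: Def (val x) [:: Ref (Path [:: lbl_parameter])];
                Def lbl_parameter [::];
                Def lbl_result (translate M)]]
  | App M1 M2 =>
      [:: Def lbl_callee (translate M1);
          Def lbl_call
            [:: Ref (Path [:: lbl_callee; lbl_whnf]);
                Def lbl_parameter (translate M2)];
          Def lbl_whnf
            [:: Ref (Path [:: lbl_call; lbl_result; lbl_whnf])]]
  end.

(* Main.v *)
Require Import Defs.
From mathcomp Require Import all_boot.

Set Implicit Arguments.
Unset Strict Implicit.
Unset Printing Implicit Defensive.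

(** [translate] is compositional: each of its clauses is a fixed mixin body into which only the
    variable name and the translated subterms are plugged, so the clause itself is the template. For
    injectivity, the clauses have distinct top-level shapes (one reference, one definition, three
    definitions) and each retains all its constituents, so a term can be read back from its
    image. *)

Lemma translate_inj : injective translate.
Proof.
elim=> [x|x M IHM|M1 IH1 M2 IH2] [y|y N|N1 N2] //=.
(* Clashing shapes are already discharged; a variable is determined by its label. *)
- by case=> /val_inj ->.
- by case=> /val_inj -> /IHM ->.
- by case=> /IH1 -> /IH2 ->.
Qed.

(** The bare numerals here and below are the hole counts that the constructor's other arguments
    leave undetermined. *)
Definition var_template : template 1 0 :=
  Body [:: TRef 0 (Path [:: LabelHole ord0])].

Definition lam_template : template 1 1 :=
  Body [:: TDef (LabelConst 1 lbl_whnf)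
    (Body [:: TDef (LabelHole ord0)
                (Body [:: TRef 1 (Path [:: LabelConst 1 lbl_parameter])]);
              TDef (LabelConst 1 lbl_parameter) (Body [::]);
              TDef (LabelConst 1 lbl_result) (BodyHole 1 ord0)])].

Definition app_template : template 0 2 :=
  Body [:: TDef (LabelConst 0 lbl_callee) (BodyHole 0 ord0);
           TDef (LabelConst 0 lbl_call)
             (Body [:: TRef 2 (Path [:: LabelConst 0 lbl_callee;
                                        LabelConst 0 lbl_whnf]);
                       TDef (LabelConst 0 lbl_parameter)
                         (BodyHole 0 ord_max)]);
           TDef (LabelConst 0 lbl_whnf)
             (Body [:: TRef 2 (Path [:: LabelConst 0 lbl_call;
                                        LabelConst 0 lbl_result;
                                        LabelConst 0 lbl_whnf])])].

Lemma translate_macro_expresses (C : construct) : macro_expresses translate C.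
Proof.
(* Filling each template computes to the matching clause of [translate]. *)
by case: C; [exists var_template | exists lam_template | exists app_template].
Qed.

Theorem theoremD6 : macro_expressible_embedding translate.
Proof. by split; [exact: translate_inj | exact: translate_macro_expresses]. Qed.
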